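(* For any positive integer $K$ and any integer $\delta\ge 2$, there exists a finite simple graph $G$ with minimum degree $\delta(G)=\delta$ and $\mathrm{Maj}(G)\ge K$.
   Context: Graphs are finite, simple and undirected. A strong majority vertex-coloring of a graph $G=(V,E)$ is a (not necessarily proper) map $c:V\to C$ into a set $C$ of colors such that for every vertex $v\in V$ and every color $\alpha\in C$, at most half of the neighbors of $v$ have color $\alpha$. The strong majority number $\mathrm{Maj}(G)$ is the least number of colors in such a coloring; it is defined for graphs with minimum degree at least $2$. *)

(* Defs.v *)
From mathcomp Require Import all_boot.

Set Implicit Arguments.
Unset Strict Implicit.
Unset Printing Implicit Defensive.

Record sgraph := SGraph {
  vertex :> finType;
  adj : rel vertex;
  adj_sym : symmetric adj;
  adj_irrefl : irreflexive adj }.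

Definition nbh (G : sgraph) (v : G) : {set G} := [set u | adj v u].

Definition deg (G : sgraph) (v : G) : nat := #|nbh v|.

(* The default value #|G| exceeds every degree, so that this is the genuine
   minimum as soon as G has a vertex; the graph without vertices gets 0. *)
Definition min_deg (G : sgraph) : nat := \big[minn/#|G|]_(v : G) deg v.

Definition strong_majority (G : sgraph) (C : finType) (c : {ffun G -> C}) : bool :=
  [forall v : G, forall alpha : C,
     2 * #|[set u in nbh v | c u == alpha]| <= deg v].

(* The colors need not all be used, which does not affect the least k. *)
Definition strong_majority_colorable (G : sgraph) (k : nat) : bool :=
  [exists c : {ffun G -> 'I_k}, strong_majority c].

Lemma min_deg_le (G : sgraph) (v : G) : min_deg G <= deg v.
Proof.
rewrite /min_deg; elim: (index_enum G) (mem_index_enum v) => [//|u s IHs].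
rewrite in_cons big_cons geq_min => /orP[/eqP-> | /IHs->]; first by rewrite leqnn.
by rewrite orbT.
Qed.

(* Giving distinct colors to distinct vertices always works when the minimum
   degree is at least 2. *)
Lemma strong_majority_colorable_ex (G : sgraph) :
  2 <= min_deg G -> exists k, strong_majority_colorable G k.
Proof.
move=> d2; exists #|G|; apply/existsP; exists [ffun v => enum_rank v].
apply/forallP=> v; apply/forallP=> alpha.
apply: leq_trans (leq_trans d2 (min_deg_le v)).
rewrite -[leqRHS]muln1 leq_mul2l /= -(cards1 (enum_val alpha)).
apply/subset_leq_card/subsetP=> u; rewrite !inE ffunE => /andP[_ /eqP<-].
by rewrite enum_rankK.
Qed.

Definition Maj (G : sgraph) (d2 : 2 <= min_deg G) : nat :=
  ex_minn (strong_majority_colorable_ex d2).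

(* Main.v *)
Require Import Defs.
From mathcomp Require Import all_boot.

(** Take a clique on a large set [B] and attach, for every [d]-subset [S] of
    [B], a new vertex with neighborhood [S].  If few colors are used, then by
    pigeonhole some [S] is monochromatic, which violates the majority
    condition at its vertex. *)

Set Implicit Arguments.
Unset Strict Implicit.
Unset Printing Implicit Defensive.

Lemma exists_subset_card (T : finType) (A : {set T}) (n : nat) :
  n <= #|A| -> exists2 S : {set T}, S \subset A & #|S| = n.
Proof.
move=> nA; exists [set x in take n (enum A)].
  by apply/subsetP=> x; rewrite inE => /mem_take; rewrite mem_enum.
rewrite cardsE (card_uniqP _) ?take_uniq ?enum_uniq //.
by rewrite size_takel // -cardE.
Qed.

Lemma pigeonhole_color_class (B C : finType) (c : B -> C) (d : nat) :
  #|C| * d < #|B| -> exists alpha, d < #|[set b | c b == alpha]|.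
Proof.
move=> ltB; apply/existsP; apply: contraLR ltB => /existsPn small.
(* Splitting [B] by color writes [#|B|] as a sum of class sizes, each at most [d] by [small]. *)
rewrite -leqNgt -sum1_card (partition_big c predT) //= -sum_nat_const.
by apply: leq_sum => alpha _; rewrite sum1dep_card leqNgt small.
Qed.

Lemma leq_min_deg (G : sgraph) (v : G) (m : nat) :
  (forall u : G, m <= deg u) -> m <= min_deg G.
Proof.
move=> le_deg; rewrite /min_deg; elim/big_ind: _ => //.
  (* The default value [#|G|] of the minimum is bounded through the vertex [v], since
     [deg v <= #|G|]. *)
  exact: leq_trans (le_deg v) (max_card _).
by move=> x y mx my; rewrite leq_min mx.
Qed.

Section SubsetGraph.

Variables (B : finType) (d : nat).

Definition dsubset := {S : {set B} | #|S| == d}.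

Definition subset_adj (u v : B + dsubset) : bool :=
  match u, v with
  | inl a, inl b => a != b
  | inl a, inr X | inr X, inl a => a \in val X
  | inr _, inr _ => false
  end.

Lemma subset_adj_sym : symmetric subset_adj.
Proof. by move=> [a|S] [b|S'] //=; rewrite eq_sym. Qed.

Lemma subset_adj_irrefl : irreflexive subset_adj.
Proof. by move=> [a|S] //=; rewrite eqxx. Qed.

Definition subset_graph := SGraph subset_adj_sym subset_adj_irrefl.

Lemma nbh_dsubset (S : dsubset) :
  nbh (inr S : subset_graph) = [set inl b | b in val S].
Proof.
apply/setP=> -[b|S']; rewrite inE /=.
  by rewrite mem_imset //; exact: inl_inj.
by apply/esym/imsetP=> -[].
Qed.

Lemma deg_dsubset (S : dsubset) : deg (inr S : subset_graph) = d.
Proof.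
by rewrite /deg nbh_dsubset card_imset ?(eqP (valP S)) //; exact: inl_inj.
Qed.

(** An attached vertex attains degree [d], and a vertex of [B] already has [#|B|.-1 >= d] neighbors
    inside the clique. *)
Lemma min_deg_subset_graph : d < #|B| -> min_deg subset_graph = d.
Proof.
move=> ltdB; have [|S _ /eqP cardS] := @exists_subset_card B setT d.
  by rewrite cardsT ltnW.
pose v : subset_graph := inr (Sub S cardS).
apply/eqP; rewrite eqn_leq -{1}(deg_dsubset (Sub S cardS)) min_deg_le /=.
apply: (leq_min_deg v) => -[b|S']; last by rewrite deg_dsubset.
have cardC : #|[set~ b]| = #|B|.-1 by rewrite cardsC1.
apply: (@leq_trans #|[set~ b]|); first by rewrite cardC -ltnS (ltn_predK ltdB).
rewrite -(card_imset _ (@inl_inj B dsubset)).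
apply/subset_leq_card/subsetP=> _ /imsetP[a ab ->].
by rewrite !inE /= eq_sym in ab *.
Qed.

Lemma subset_graph_not_colorable (k : nat) :
  0 < d -> k * d < #|B| -> ~~ strong_majority_colorable subset_graph k.
Proof.
move=> d_gt0 ltB; apply/existsP=> -[c /forallP maj_c].
have [|alpha dlt] := @pigeonhole_color_class B 'I_k (fun b => c (inl b)) d.
  by rewrite card_ord.
have [S /subsetP mono /eqP cardS] := exists_subset_card (ltnW dlt).
pose v : subset_graph := inr (Sub S cardS).
have /forallP/(_ alpha) := maj_c v.
(* If all [d] neighbors of [v] have color [alpha], the majority condition reads [2 * d <= d], which
   is false for [d > 0]. *)
suff -> : [set u in nbh v | c u == alpha] = nbh v.
  by rewrite -/(deg v) deg_dsubset leqNgt ltn_Pmull.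
apply/setP=> u; rewrite inE andb_idr // nbh_dsubset => /imsetP[b bS ->].
by have := mono b bS; rewrite inE.
Qed.

End SubsetGraph.

Theorem theorem6 (K : nat) (K_gt0 : 0 < K) (delta : nat) (delta_ge2 : 2 <= delta) :
  exists (G : sgraph) (d2 : 2 <= min_deg G),
    min_deg G = delta /\ K <= Maj d2.
Proof.
(* The clique size [K * delta + 1] exceeds [delta], as [K > 0], and exceeds [k * delta] for every
   [k < K]. *)
pose G := subset_graph 'I_(K * delta).+1 delta.
have minG : min_deg G = delta.
  by apply: min_deg_subset_graph; rewrite card_ord ltnS leq_pmull.
have d2 : 2 <= min_deg G by rewrite minG.
(* A coloring with [k = Maj d2] colors exists, so it suffices to refute colorability for every
   [k < K]. *)
exists G, d2; split=> //; rewrite /Maj; case: ex_minnP => k col_k _.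
apply: contraLR col_k; rewrite -ltnNge => ltkK.
apply: subset_graph_not_colorable; first exact: ltnW.
by rewrite card_ord ltnS leq_mul2r ltnW ?orbT.
Qed.
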